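(* Let $n,k,s,t$ be integers with $k\ge 2$, $s\ge 2$, $t\in[2,s]$ and $n>s+t+k-3$. Let $\mathcal F\subset\binom{[n]}{k}$ have property $U(s,s+t+k-3)$, i.e. $|F_1\cup\ldots\cup F_s|\le s+t+k-3$ for all $F_1,\ldots,F_s\in\mathcal F$. Then $$|\mathcal F|\le\max\big\{|\mathcal A(s+t+k-3,k,n,k)|,\ |\mathcal A(t+k-3,k-1,n,k)|\big\}.$$
   Context: For integers $p\ge r\ge 0$, $\mathcal A(p,r,n,k):=\{A\in\binom{[n]}{k}: |A\cap[p]|\ge r\}$, where $\binom{[n]}{k}$ is the set of $k$-subsets of $[n]=\{1,\ldots,n\}$ and $[p]=\{1,\ldots,p\}$. The sets $F_i$ need not be distinct. *)

(* Defs.v *)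
From mathcomp Require Import all_boot.

Set Implicit Arguments.
Unset Strict Implicit.
Unset Printing Implicit Defensive.

(* The ground set [n] = {1, ..., n} is represented by 'I_n = {0, ..., n-1},
   so that the initial segment [p] becomes {i : 'I_n | i < p}. *)

Definition ksubsets (n k : nat) : {set {set 'I_n}} :=
  [set A : {set 'I_n} | #|A| == k].

Definition segment (n p : nat) : {set 'I_n} := [set i : 'I_n | i < p].

Definition frankl_family (p r n k : nat) : {set {set 'I_n}} :=
  [set A in ksubsets n k | r <= #|A :&: segment n p|].

(* Property U(s, q); the s members of F need not be distinct. *)
Definition property_U (n s q : nat) (F : {set {set 'I_n}}) : Prop :=
  forall G : 'I_s -> {set 'I_n},
    (forall i, G i \in F) -> #|\bigcup_(i < s) G i| <= q.

(* Main.v *)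
Require Import Defs.
From mathcomp Require Import all_boot.
From mathcomp Require Import zify.

Set Implicit Arguments.
Unset Strict Implicit.
Unset Printing Implicit Defensive.

(** Shifting reduces the claim to a shifted family. Put K = k - 2. If such a
    family contains the sets {0..K-1, K+l, K+2t-1-l} for l < t and the sets
    {0..K-1, K, K+t+l} for t <= l < s, these s sets cover the first s+t+K
    points, one more than allowed. If a set of the second kind is missing, every
    member lies inside the first s+t+k-3 points. If {0..K-1, a, b} of the first
    kind is missing, every member lies in the first b points or has k-1
    elements among the first a. There are C(b,k) + C(a,k-1)(n-b) such k-sets;
    with a = K+l and b = K+2t-1-l this is convex in l, and its values at l = 0
    and l = t-1 are bounded by the two families of the theorem. *)

(** * Sizes of the families that bound a shifted family *)

Section Counting.
Variable n : nat.
Implicit Types (A B : {set 'I_n}).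

Lemma card_segment p : p <= n -> #|segment n p| = p.
Proof.
move=> le_pn; rewrite /segment cardsE -sum1_card.
by rewrite -(big_ord_widen _ (fun=> 1)) // sum1_card card_ord.
Qed.

(** A missing test set with top elements [a < b] confines a shifted family to this one. *)
Definition two_level_family (a b k : nat) : {set {set 'I_n}} :=
  frankl_family b k.+1 n k.+1 :|: frankl_family a k n k.+1.

Lemma in_frankl_family p r k A :
  (A \in frankl_family p r n k) = (#|A| == k) && (r <= #|A :&: segment n p|).
Proof. by rewrite !inE. Qed.

Lemma in_frankl_familyT p k A :
  (A \in frankl_family p k n k) = (A \subset segment n p) && (#|A| == k).
Proof.
rewrite in_frankl_family andbC; case: eqP => [<-|]; rewrite ?andbF ?andbT //.
by rewrite (sameP setIidPl eqP) eqEcard subsetIl.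
Qed.

Lemma card_frankl_familyT p k :
  p <= n -> #|frankl_family p k n k| = 'C(p, k).
Proof.
move=> le_pn; rewrite -[in RHS](card_segment le_pn) -cards_draws.
by apply: eq_card => A; rewrite in_frankl_familyT inE.
Qed.

(** A member of the second family that is not in the first has exactly [k] elements below [a] and
    one element [x] outside the first [b] points, so such members correspond to pairs [(S, x)]. *)
Lemma card_two_level a b k : a <= b <= n ->
  #|two_level_family a b k| = 'C(b, k.+1) + 'C(a, k) * (n - b).
Proof.
move=> /andP[le_ab le_bn]; have le_an := leq_trans le_ab le_bn.
rewrite /two_level_family cardsU -addnBA ?subset_leq_card ?subsetIr //.
rewrite setIC -cardsD card_frankl_familyT //; congr (_ + _).
pose D := [set S : {set 'I_n} | S \subset segment n a & #|S| == k].
pose f (p : {set 'I_n} * 'I_n) := p.2 |: p.1.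
have fa S x : S \in D -> x \in ~: segment n b -> f (S, x) :&: segment n a = S.
  rewrite !inE -leqNgt => /andP[/subsetP SD _] le_bx.
  apply/setP => y; rewrite !inE; case: eqP => [->|_] /=.
    case: (boolP (x \in S)) => [/SD|_]; rewrite ?inE ltnNge (leq_trans le_ab) //.
  by case: (boolP (y \in S)) => // /SD; rewrite inE.
have fb S x : S \in D -> x \in ~: segment n b -> f (S, x) :\: segment n b = [set x].
  rewrite !inE -leqNgt => /andP[/subsetP SD _] le_bx.
  apply/setP => y; rewrite !inE -leqNgt; case: eqP => [->|_] /=; first by rewrite le_bx.
  case: (boolP (y \in S)) => [/SD|_]; rewrite ?inE ?andbF // => lt_ya.
  by rewrite leqNgt (leq_trans lt_ya).
have f_inj : {in setX D (~: segment n b) &, injective f}.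
  move=> [S x] [T y] /setXP[/= SD xD] /setXP[/= TD yD] eqf; congr pair.
    by rewrite -(fa S x) // eqf fa.
  by apply: set1_inj; rewrite -(fb S x) // eqf fb.
suff -> : frankl_family a k n k.+1 :\: frankl_family b k.+1 n k.+1
          = f @: setX D (~: segment n b).
  rewrite card_in_imset // cardsX cards_draws card_segment //.
  by rewrite cardsCs setCK card_segment // card_ord.
apply/setP => A; apply/idP/imsetP.
  rewrite inE in_frankl_familyT in_frankl_family => /andP[+ /andP[/eqP cA leA]].
  rewrite cA eqxx andbT => /subsetPn[x Ax bx].
  have xa : x \notin segment n a by move: bx; rewrite !inE; lia.
  have sub : A :&: segment n a \subset A :\ x.
    apply/subsetP => y; rewrite !inE => /andP[-> ya]; rewrite andbT.
    by apply: contraNneq xa => <-; rewrite inE.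
  have cAx : #|A :\ x| = k by move: (cardsD1 x A); rewrite Ax cA => -[].
  have eqS : A :&: segment n a = A :\ x by apply/eqP; rewrite eqEcard sub cAx.
  exists (A :\ x, x); last by rewrite /f /= setD1K.
  by apply/setXP; split; rewrite /= inE ?bx // -{1}eqS subsetIr cAx eqxx.
move=> [[S x] /setXP[/= SD xD] ->].
have xS : x \notin S.
  by move: SD xD; rewrite !inE -leqNgt => /andP[/subsetP SD _]; apply: contraTN => /SD; rewrite inE; lia.
rewrite inE in_frankl_familyT in_frankl_family fa // /f /= cardsU1 xS.
move: SD; rewrite inE => /andP[_ /eqP ->]; rewrite eqxx leqnn !andbT.
by apply: contraTN xD => /subsetP/(_ x (setU11 _ _)); rewrite !inE => ->.
Qed.

End Counting.

(** * Convexity of the counts *)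

Lemma convex_le_max_endpoints (f : nat -> nat) m :
  (forall u, u.+2 <= m -> 2 * f u.+1 <= f u + f u.+2) ->
  forall u, u <= m -> f u <= maxn (f 0) (f m).
Proof.
elim: m => [|m IH] cvx u; first by rewrite leqn0 => /eqP->; rewrite maxnn.
rewrite leq_eqVlt => /orP[/eqP->|lt_um]; first exact: leq_maxr.
have {}IH := IH (fun v lt_vm => cvx v (leqW lt_vm)) u lt_um.
suff lem : f m <= maxn (f 0) (f m.+1) by apply: leq_trans IH _; lia.
have [lt_f|] := ltnP (f m.+1) (f m); last by lia.
(* A descent at the last step propagates backwards by convexity, which gives [f m <= f 0]. *)
have dec v : v <= m -> f (m - v).+1 <= f (m - v) /\ f m <= f (m - v).
  elim: v => [|v IHv] le_vm; first by rewrite subn0; lia.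
  have [] := IHv (ltnW le_vm); have := cvx (m - v.+1).
  by rewrite (_ : m - v = (m - v.+1).+1); lia.
by have [_] := dec m (leqnn _); rewrite subnn; lia.
Qed.

(** By Pascal's rule the binomials have nonnegative second differences. For the product with
    [g a = 'C(a, k)], the second difference is [c] times that of [g] plus
    [2 * (g a.+2 - g a.+1)]. *)
Lemma two_level_count_convex k a b c :
  2 * ('C(b.+1, k.+1) + 'C(a.+1, k) * c.+1)
  <= ('C(b.+2, k.+1) + 'C(a, k) * c) + ('C(b, k.+1) + 'C(a.+2, k) * c.+2).
Proof.
have := @leq_bin2l b b.+1 k (leqnSn _).
rewrite [in 'C(b.+2, _)]binS [in 'C(b.+1, k.+1)]binS.
case: k => [|k]; first by rewrite !bin0 !bin1; lia.
have := @leq_bin2l a a.+1 k (leqnSn _).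
rewrite ['C(a.+2, _)]binS ['C(a.+1, k.+1)]binS.
move: ('C(a, k)) ('C(a.+1, k)) ('C(a, k.+1)) => x y z; nia.
Qed.

(** * Shifting, and domination in shifted families *)

Section Shifting.
Variable n : nat.
Implicit Types (A B : {set 'I_n}) (F : {set {set 'I_n}}) (i j x : 'I_n).

Definition replace i j A : {set 'I_n} := i |: (A :\ j).

Definition shift_set i j F A : {set 'I_n} :=
  if [&& j \in A, i \notin A & replace i j A \notin F] then replace i j A else A.

Definition shift_family i j F : {set {set 'I_n}} := shift_set i j F @: F.

Definition shifted F : Prop :=
  forall i j A, i < j -> A \in F -> j \in A -> i \notin A -> replace i j A \in F.

Lemma replaceK i j A : j \in A -> i \notin A -> replace j i (replace i j A) = A.
Proof.
move=> jA iA; apply/setP => x; rewrite !inE.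
have [->|xj] := eqVneq x j; first by rewrite jA.
by have [->|] := eqVneq x i; rewrite ?(negPf iA).
Qed.

Lemma card_replace i j A : j \in A -> i \notin A -> #|replace i j A| = #|A|.
Proof. by move=> jA iA; rewrite cardsU1 !inE (negPf iA) andbF (cardsD1 j A) jA. Qed.

(** A moved set can be moved back, and it lies outside [F], so it never meets an unmoved one. *)
Lemma shift_set_inj i j F : {in F &, injective (shift_set i j F)}.
Proof.
move=> A B FA FB; rewrite /shift_set.
case: ifP => [/and3P[jA iA nA]|_]; case: ifP => [/and3P[jB iB nB]|_] // eqAB.
- by rewrite -(replaceK jA iA) eqAB replaceK.
- by rewrite eqAB FB in nA.
- by rewrite -eqAB FA in nB.
Qed.

Lemma card_shift_family i j F : #|shift_family i j F| = #|F|.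
Proof. exact: card_in_imset (@shift_set_inj i j F). Qed.

Lemma shift_family_uniform i j k F :
  F \subset ksubsets n k -> shift_family i j F \subset ksubsets n k.
Proof.
move=> /subsetP Fk; apply/subsetP => _ /imsetP[A /Fk + ->].
rewrite !inE /shift_set; case: ifP => // /and3P[jA iA _].
by rewrite card_replace.
Qed.

Lemma mem_shift_family i j F B : i != j -> B \in shift_family i j F ->
  if B \in F then j \in B -> i \notin B -> replace i j B \in F
  else [/\ i \in B, j \notin B & replace j i B \in F].
Proof.
move=> ij /imsetP[A FA ->]; rewrite /shift_set.
have [/and3P[jA iA nA]|] := boolP [&& j \in A, i \notin A & _].
  rewrite (negPf nA); split; last by rewrite replaceK.
    exact: setU11.
  by rewrite !inE eqxx orbF eq_sym.
by rewrite FA => + jA iA; rewrite jA iA negbK.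
Qed.

Lemma shift_family_property_U i j s q F :
  i != j -> property_U s q F -> property_U s q (shift_family i j F).
Proof.
move=> ij UF G GF; have memG l := mem_shift_family ij (GF l).
have [/forallP allF|/forallPn[l0 nF0]] := boolP [forall l, G l \in F].
  exact: UF.
(* Sets outside [F] are moved back. Sets of [F] with [j] but not [i] are shifted, which stays in
   [F], so that [i] is in [H l] whenever [j] is in [G l]. *)
pose H l := if G l \in F then
  if (j \in G l) && (i \notin G l) then replace i j (G l) else G l
  else replace j i (G l).
have HF l : H l \in F.
  rewrite /H; move: (memG l); case: ifP => [GlF|_ []] //.
  by case: ifP => // /andP[jG iG] /(_ jG iG).
have eqH l x : x != i -> x != j -> (x \in H l) = (x \in G l).
  move=> xi xj; rewrite /H.
  by case: ifP => _; [case: ifP => _|]; rewrite ?inE ?xi ?xj ?(negPf xi) ?(negPf xj).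
have jH : j \in \bigcup_l H l.
  by apply/bigcupP; exists l0; rewrite // /H (negPf nF0) setU11.
have iG : i \in \bigcup_l G l.
  by apply/bigcupP; exists l0 => //; move: (memG l0); rewrite (negPf nF0) => -[].
apply: leq_trans (UF H HF).
(* Either the union of [H] contains that of [G], or [j] in the former makes up for [i] in the
   latter. *)
have [/bigcupP[m _ jG]|jG] := boolP (j \in \bigcup_l G l).
  have iH : i \in \bigcup_l H l.
    apply/bigcupP; exists m => //; rewrite /H; move: (memG m); rewrite jG /=.
    case: ifP => [_ _|_ [_]] //.
    by have [|/negbNE] := ifPn (i \notin G m); rewrite ?setU11.
  apply/subset_leq_card/subsetP => x /bigcupP[l _ xG].
  have [->//|xi] := eqVneq x i; have [->//|xj] := eqVneq x j.
  by apply/bigcupP; exists l; rewrite ?eqH.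
rewrite (cardsD1 i) iG (cardsD1 j (\bigcup_l H l)) jH leq_add2l.
apply/subset_leq_card/subsetP => x; rewrite !inE => /andP[xi xG].
have xj : x != j by apply: contraNneq jG => <-.
rewrite xj; have /bigcupP[l _ xGl] := xG.
by apply/bigcupP; exists l; rewrite ?eqH.
Qed.

Definition weight F := \sum_(A in F) \sum_(x in A) x.

Lemma sum_replace i j A (f : 'I_n -> nat) : j \in A -> i \notin A ->
  \sum_(x in replace i j A) f x + f j = \sum_(x in A) f x + f i.
Proof.
move=> jA iA; rewrite big_setU1 ?inE ?(negPf iA) ?andbF //=.
by rewrite [in RHS](big_setD1 j jA) /= addnC addnCA addnC.
Qed.

Lemma sum_replace_lt i j A : i < j -> j \in A -> i \notin A ->
  \sum_(x in replace i j A) x < \sum_(x in A) x.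
Proof.
move=> ij jA iA; rewrite -(ltn_add2r i) -(sum_replace (@nat_of_ord n) jA iA).
by rewrite ltn_add2l.
Qed.

Lemma weight_shift_family i j A F : i < j -> A \in F -> j \in A -> i \notin A ->
  replace i j A \notin F -> weight (shift_family i j F) < weight F.
Proof.
move=> ij FA jA iA nA.
rewrite /weight big_imset /=; last exact: shift_set_inj.
rewrite (big_setD1 A FA) [ltnRHS](big_setD1 A FA) /= -addSn leq_add //.
  by rewrite /shift_set jA iA nA; apply: sum_replace_lt.
apply: leq_sum => B _; rewrite /shift_set; case: ifP => // /and3P[jB iB _].
exact/ltnW/sum_replace_lt.
Qed.

(* A shift that moves some member lowers [weight], so a family of least weight
   is shifted. *)
Lemma exists_shifted k s q F : F \subset ksubsets n k -> property_U s q F ->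
  exists F', [/\ #|F'| = #|F|, F' \subset ksubsets n k, property_U s q F' & shifted F'].
Proof.
have [w] := ubnP (weight F); elim: w F => // w IHw F ltFw Fk UF.
pose bad (p : 'I_n * 'I_n * {set 'I_n}) := let: (i, j, A) := p in
  [&& i < j, A \in F, j \in A, i \notin A & replace i j A \notin F].
have [/existsP[[[i j] A] /and5P[ij FA jA iA nA]]|/existsPn nbad] := boolP [exists p, bad p].
  have [||F' [cF' F'k UF' sF']] := IHw (shift_family i j F) _ (shift_family_uniform i j Fk).
  - by rewrite (leq_trans (weight_shift_family ij FA jA iA nA)).
  - by apply: shift_family_property_U => //; rewrite neq_ltn ij.
  by exists F'; split=> //; rewrite cF' card_shift_family.
exists F; split=> // i j A ij FA jA iA.
by have := nbad (i, j, A); rewrite /= ij FA jA iA /= negbK.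
Qed.

Lemma cardsI_replace i j A S : j \in A -> i \notin A ->
  #|replace i j A :&: S| + (j \in S) = #|A :&: S| + (i \in S).
Proof.
have cardI B : #|B :&: S| = \sum_(x in B) (x \in S).
  rewrite -sum1_card big_mkcond [RHS]big_mkcond; apply: eq_bigr => x _.
  by rewrite inE; case: (x \in B); case: (x \in S).
by move=> jA iA; rewrite !cardI (sum_replace (fun x => x \in S : nat)).
Qed.

(** Trade the least [j] of [A :\: B] for the least [i] of [B :\: A]: this is a downward shift, keeps
    the domination and brings [A] closer to [B]. *)
Lemma shifted_dominated F A B : shifted F -> A \in F -> #|A| = #|B| ->
  (forall m, #|A :&: segment n m| <= #|B :&: segment n m|) -> B \in F.
Proof.
move=> sF; have [d] := ubnP #|A :\: B|; elim: d A => // d IHd A ltd FA cAB dom.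
have [AB|/subsetPn[j0 jA0 jB0]] := boolP (A \subset B).
  by have /eqP <- : A == B by rewrite eqEcard AB cAB leqnn.
have /subsetPn[i0 iB0 iA0] : ~~ (B \subset A).
  apply: contra jB0 => BA; suff /eqP -> : B == A by [].
  by rewrite eqEcard BA cAB leqnn.
have Pj0 : j0 \in A :\: B by rewrite inE jB0.
have Pi0 : i0 \in B :\: A by rewrite inE iA0.
case: (@arg_minnP _ j0 [in A :\: B] (@nat_of_ord n) Pj0) => j; rewrite /= inE => /andP[jB jA] minA.
have minj x : x \in A -> x \notin B -> j <= x by move=> xA xB; rewrite minA // inE xB.
case: (@arg_minnP _ i0 [in B :\: A] (@nat_of_ord n) Pi0) => i; rewrite /= inE => /andP[iA iB] minB.
have mini x : x \in B -> x \notin A -> i <= x by move=> xB xA; rewrite minB // inE xA.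
have ij : i < j.
  rewrite ltnNge leq_eqVlt negb_or; apply/andP; split.
    by apply: contraNneq jB => /val_inj ->.
  (* If [j < i], then up to [j] all of [B] lies in [A], which also has [j], against domination at
     [j.+1]. *)
  apply/negP => ji; have := dom j.+1; rewrite leqNgt => /negP[].
  apply: proper_card; apply/properP; split; last first.
    by exists j; rewrite !inE ?jA ?leqnn ?(negPf jB).
  apply/subsetP => x; rewrite !inE => /andP[xB xj]; rewrite xj andbT.
  apply/negPn/negP => xA; have := leq_trans ji (mini x xB xA).
  by rewrite ltnNge -ltnS xj.
have FA' := sF i j A ij FA jA iA.
apply: (IHd (replace i j A)) => //; last 1 first.
- move=> m; have := cardsI_replace (segment n m) jA iA; rewrite !inE.
  have [im|mi] := ltnP i m; last first.
    by rewrite ltnNge (leq_trans mi (ltnW ij)) /= !addn0 => ->.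
  have [jm|jm] := ltnP j m; first by move/addIn->.
  (* For [i < m <= j] the count of [A] grows by one; there was room, since below [m] the set [B]
     contains [A] and also has [i]. *)
  rewrite addn0 addn1 => ->.
  apply: proper_card; apply/properP; split; last first.
    by exists i; rewrite !inE ?iB ?im ?(negPf iA).
  apply/subsetP => x; rewrite !inE => /andP[xA xm]; rewrite xm andbT.
  apply/negPn/negP => xB; have := leq_trans jm (minj x xA xB).
  by rewrite leqNgt xm.
- rewrite -ltnS; apply: leq_trans ltd; rewrite ltnS.
  apply: proper_card; apply/properP; split; last first.
    exists j; first by rewrite inE jB jA.
    by rewrite !inE eqxx orbF -val_eqE /= gtn_eqF ?andbF.
  apply/subsetP => x; rewrite !inE; case: eqP => [->|_] /=; first by rewrite iB.
  by case/and3P=> -> _ ->.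
- by rewrite card_replace.
Qed.

End Shifting.

(** * Test sets: what a missing one forces, and what they cover together *)

Section TestSets.
Variable n : nat.
Implicit Types (A : {set 'I_n}) (F : {set {set 'I_n}}).

Lemma segmentS p r : p <= r -> segment n p \subset segment n r.
Proof. by move=> le_pr; apply/subsetP => x; rewrite !inE => /leq_trans; apply. Qed.

Lemma cardsI_segment_le A p r :
  p <= r -> #|A :&: segment n p| <= #|A :&: segment n r|.
Proof. by move=> le_pr; apply/subset_leq_card/setIS/segmentS. Qed.

Lemma frankl_family_step p r k : p < n ->
  frankl_family p.+1 r.+1 n k \subset frankl_family p r n k.
Proof.
move=> lt_pn; apply/subsetP => A; rewrite !in_frankl_family => /andP[-> /=].
have sub : A :&: segment n p.+1 \subset Ordinal lt_pn |: (A :&: segment n p).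
  apply/subsetP => x; rewrite !inE ltnS leq_eqVlt -val_eqE /=.
  by case/andP=> -> /orP[->|->] //; rewrite orbT.
move=> /leq_trans/(_ (subset_leq_card sub)); rewrite cardsU1.
by case: (_ \notin _) => //= /ltnW.
Qed.

Definition test_set (K a b : nat) : {set 'I_n} :=
  [set x : 'I_n | [|| x < K, x == a :> nat | x == b :> nat]].

Lemma card_test_setI K a b m : K <= a < b -> b < n ->
  #|test_set K a b :&: segment n m| = minn m K + (a < m) + (b < m).
Proof.
move=> /andP[le_Ka lt_ab] lt_bn; have lt_an := ltn_trans lt_ab lt_bn.
have cardI1 c (lt_cn : c < n) : #|[set Ordinal lt_cn] :&: segment n m| = (c < m).
  case: ltnP => cm.
    by rewrite (setIidPl _) ?cards1 // sub1set inE.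
  apply/eqP; rewrite cards_eq0; apply/eqP/setP => x; rewrite !inE -val_eqE /=.
  by apply: contraTF cm => /andP[/eqP->]; rewrite -ltnNge.
have -> : test_set K a b :&: segment n m = segment n (minn m K)
    :|: ([set Ordinal lt_an] :&: segment n m) :|: ([set Ordinal lt_bn] :&: segment n m).
  apply/setP => x; rewrite !inE -!val_eqE /= leq_min.
  by case: (x < m); rewrite ?andbT ?andbF ?orbF // orbA.
rewrite !cardsU !cardI1 card_segment; last by rewrite geq_min (leq_trans le_Ka (ltnW lt_an)) orbT.
rewrite [X in _ + _ - X + _]( _ : _ = 0) ?[X in _ + _ - X](_ : _ = 0) ?subn0 //.
  apply/eqP; rewrite cards_eq0; apply/eqP/setP => x; rewrite !inE -!val_eqE /= leq_min.
  by apply/negP => H; lia.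
apply/eqP; rewrite cards_eq0; apply/eqP/setP => x; rewrite !inE -!val_eqE /= leq_min.
by apply/negP => H; lia.
Qed.

Lemma card_test_set K a b : K <= a < b -> b < n -> #|test_set K a b| = K.+2.
Proof.
move=> leK lt_bn; have := @card_test_setI K a b n leK lt_bn.
have /setIidPl -> : test_set K a b \subset segment n n.
  by apply/subsetP => x _; rewrite inE.
by lia.
Qed.

(* Every (K+2)-set outside [two_level_family a b K.+1] dominates [test_set K a b]
   componentwise. *)
Lemma sub_two_level K a b F : K <= a < b -> b < n ->
  F \subset ksubsets n K.+2 -> shifted F -> test_set K a b \notin F ->
  F \subset two_level_family n a b K.+1.
Proof.
move=> leK lt_bn /subsetP Fk sF nF; apply/subsetP => A FA.
have cA : #|A| = K.+2 by move: (Fk A FA); rewrite inE => /eqP.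
rewrite inE !in_frankl_family cA eqxx /=; apply: contraR nF.
rewrite negb_or -!ltnNge !ltnS => /andP[leb lea].
apply: (shifted_dominated sF FA); first by rewrite card_test_set.
move=> m; rewrite card_test_setI //.
have leA : #|A :&: segment n m| <= K.+2 by rewrite -cA subset_leq_card ?subsetIl.
have lem : #|A :&: segment n m| <= m.
  have [le_nm|lt_mn] := leqP n m; last first.
    by rewrite -[leqRHS](card_segment (ltnW lt_mn)) subset_leq_card ?subsetIr.
  by apply: leq_trans le_nm; rewrite -[leqRHS](card_ord n) max_card.
(* [A] has at most [K] elements below [a] and [K.+1] below [b]. The bound needed is [K.+2] for
   [m > b], [K.+1] for [a < m <= b] and [minn m K] for [m <= a]. *)
have mona := @cardsI_segment_le A m a; have monb := @cardsI_segment_le A m b.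
case: (ltnP a m) mona => am mona; case: (ltnP b m) monb => bm monb.
- by move: leA; lia.
- by have := leq_trans (monb isT) leb; lia.
- by lia.
- by have := leq_trans (mona isT) lea; lia.
Qed.

(* The test sets with [l < t] pair up [K .. K + 2t - 1] as a nested matching,
   the others add one new element each. *)
Lemma bigcup_test_sets K s t : 0 < t <= s ->
  segment n (s + t + K) \subset
  \bigcup_(l < s) (if l < t then test_set K (K + l) (K + t.*2.-1 - l)
                   else test_set K K (K + t + l)).
Proof.
move=> /andP[t0 le_ts]; apply/subsetP => x; rewrite inE => ltx.
have cover l (lt_ls : l < s) : x \in (if l < t then test_set K (K + l) (K + t.*2.-1 - l)
                   else test_set K K (K + t + l)) ->
    x \in \bigcup_(l < s) (if l < t then test_set K (K + l) (K + t.*2.-1 - l)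
                   else test_set K K (K + t + l)).
  by move=> xl; apply/bigcupP; exists (Ordinal lt_ls).
have [xK|Kx] := ltnP x K.
  by apply: (cover 0); [lia | rewrite t0 inE xK].
(* Here [x] is a lower end of the matching, next an upper end, and finally the top element of an
   unmatched set. *)
have [xt|tx] := ltnP x (K + t).
  apply: (cover (x - K)); first lia.
  by rewrite (_ : x - K < t) ?inE; lia.
have [x2|x2] := ltnP x (K + t.*2).
  apply: (cover (K + t.*2.-1 - x)); first lia.
  by rewrite (_ : K + t.*2.-1 - x < t) ?inE; lia.
apply: (cover (x - K - t)); first lia.
by rewrite ltnNge (_ : t <= x - K - t) ?inE /=; lia.
Qed.

End TestSets.

(** * Comparison with the two extremal families, and conclusion *)

Lemma two_level_le_max n s t K l :
  1 < t <= s -> s + t + K <= n -> l < t ->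
  #|two_level_family n (K + l) (K + t.*2.-1 - l) K.+1|
  <= maxn #|frankl_family (s + t + K).-1 K.+2 n K.+2|
          #|frankl_family (K + t).-1 K.+1 n K.+2|.
Proof.
move=> /andP[t1 le_ts] le_n lt_lt.
pose f u := 'C(K + t.*2.-1 - u, K.+2) + 'C(K + u, K.+1) * (n - (K + t.*2.-1 - u)).
have fE u : u < t -> #|two_level_family n (K + u) (K + t.*2.-1 - u) K.+1| = f u.
  by move=> lt_ut; rewrite card_two_level //; lia.
rewrite fE //; apply: leq_trans (_ : _ <= maxn (f 0) (f t.-1)) _.
  apply: convex_le_max_endpoints; last by lia.
  move=> u le_ut; rewrite /f.
  (* As [u] grows, [b] falls while [a] and [n - b] rise, so the smallest [b] is the one at
     [u.+2]. *)
  have := @two_level_count_convex K.+1 (K + u) (K + t.*2.-1 - u.+2) (n - (K + t.*2.-1 - u)).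
  rewrite (_ : (K + t.*2.-1 - u.+2).+2 = K + t.*2.-1 - u); last lia.
  rewrite (_ : (K + t.*2.-1 - u.+2).+1 = K + t.*2.-1 - u.+1); last lia.
  rewrite (_ : (n - (K + t.*2.-1 - u)).+2 = n - (K + t.*2.-1 - u.+2)); last lia.
  rewrite (_ : (n - (K + t.*2.-1 - u)).+1 = n - (K + t.*2.-1 - u.+1)); last lia.
  by rewrite -!addnS.
rewrite geq_max !leq_max; apply/andP; split; apply/orP; [left | right].
  (* At [u = 0] the second term has the factor ['C(K, K.+1) = 0], and [t <= s] bounds the first. *)
  rewrite card_frankl_familyT; last lia.
  by rewrite /f addn0 subn0 (@bin_small K) // mul0n addn0 leq_bin2l //; lia.
(* At [u = t.-1] we have [b = a.+1], so the first level is absorbed by the second. *)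
rewrite -fE; last lia.
apply: subset_leq_card; rewrite subUset (_ : K + t.-1 = (K + t).-1) ?subxx; last lia.
rewrite (_ : K + t.*2.-1 - t.-1 = (K + t).-1.+1) ?andbT; last lia.
by apply: frankl_family_step; lia.
Qed.

Theorem theorem6 (n k s t : nat) (hk : 2 <= k) (hs : 2 <= s)
    (ht : 2 <= t <= s) (hn : s + t + k - 3 < n)
    (F : {set {set 'I_n}}) (hF : F \subset ksubsets n k)
    (hU : property_U s (s + t + k - 3) F) :
  #|F| <= maxn #|frankl_family (s + t + k - 3) k n k|
               #|frankl_family (t + k - 3) k.-1 n k|.
Proof.
case: k => [|[|K]] // in hk hn hF hU *.
rewrite (_ : s + t + K.+2 - 3 = (s + t + K).-1) in hn hU *; last lia.
rewrite (_ : t + K.+2 - 3 = (K + t).-1) /=; last lia.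
have [F' [<- F'k UF' sF']] := exists_shifted hF hU.
pose G (l : 'I_s) := if l < t then test_set n K (K + l) (K + t.*2.-1 - l)
                     else test_set n K K (K + t + l).
have [/forallP GF|/forallPn[l nF]] := boolP [forall l, G l \in F'].
  have := UF' G GF; have sub := @bigcup_test_sets n K s t.
  (* By [hn] the ground set has at least [s + t + K] points, one more than [hU] allows to be
     covered. *)
  have := subset_leq_card (sub _); rewrite card_segment; last lia.
  by move=> /(_ ltac:(lia)) /leq_trans H /H; lia.
move: nF; rewrite /G; case: ltnP => lt_lt nF.
  apply: leq_trans (two_level_le_max ht _ lt_lt); last lia.
  by apply/subset_leq_card/sub_two_level => //; lia.
rewrite leq_max; apply/orP; left; apply: subset_leq_card.
have lt_ls := ltn_ord l.
apply: subset_trans (sub_two_level _ _ F'k sF' nF) _; try lia.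
rewrite subUset; apply/andP; split; apply/subsetP => A; rewrite !in_frankl_family.
  by case/andP=> -> /leq_trans; apply; apply: cardsI_segment_le; lia.
(* With [a = K] the second level is empty: [K] points cannot hold [K.+1] elements. *)
case/andP=> _ /leq_trans/(_ (subset_leq_card (subsetIr _ _))).
by rewrite card_segment ?ltnn //; lia.
Qed.
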